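(* Let $e>r\ge 3$ and $w\ge 0$ be integers, let $\mu\in\Gamma_r(w)$ and $0\le i\le r-1$, and suppose that $\mu\sigma_i$ is defined. Then either $\mu\sigma_i=\mu$, or the $e$-alcove $\mathcal{A}_\mu\sigma_i:=\mathcal{A}_{\mu\sigma_i}$ has a common facet with $\mathcal{A}_\mu$.
   Context: Weak compositions and the partial action. $\Gamma_r(w)$ is the set of weak compositions of $w$ of length $r$, i.e. sequences $\mu=(\mu_1,\dots,\mu_r)$ of non-negative integers with sum $w$. Let $\sigma_0,\dots,\sigma_{r-1}$ be the simple reflections of the affine Weyl group of type $A_{r-1}^{(1)}$. For $1\le i\le r-1$, $\mu\sigma_i$ is obtained from $\mu$ by swapping the $i$-th and $(i+1)$-th entries (always defined). Further, $\mu\sigma_0=(\mu_r+1,\mu_2,\dots,\mu_{r-1},\mu_1-1)$, which is defined if and only if $\mu_1\ge 1$. Weights. A partition $\lambda$ with at most $r$ parts (padded by zeros) has $r$-beta numbers $\beta_t=\lambda_t+r-t$ for $1\le t\le r$; these are strictly decreasing non-negative integers determining $\lambda$. Its $e$-abacus with $r$ beads has runners $0,\dots,e-1$ and rows $0,1,2,\dots$, with the bead $\beta_t=ae+b$, $0\le b\le e-1$, placed in row $a$ of runner $b$. Put $\Omega(\lambda)=\sum_{t=1}^{r-1}(\beta_t-\beta_{t+1})\Lambda_t$ in the weight lattice $P=\bigoplus_{t=1}^{r-1}\mathbb{Z}\Lambda_t$ of $\mathfrak{sl}_r$. Alcoves. Let $E=\{x\in\mathbb{R}^r:\sum x_t=0\}=P\otimes\mathbb{R}$,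 with simple roots $\alpha_t=\varepsilon_t-\varepsilon_{t+1}$ and positive roots $R^+=\{\varepsilon_s-\varepsilon_t:1\le s<t\le r\}$; here $\alpha^\vee=\alpha$ and $\langle\alpha_s^\vee,\Lambda_t\rangle=\delta_{st}$. The $e$-alcoves are the connected components of the complement in $E$ of all hyperplanes $\{x:\langle\alpha^\vee,x\rangle=ke\}$, $\alpha\in R^+$, $k\in\mathbb{Z}$. An $e$-alcove is dominant if it is contained in $\{x:\langle\alpha_t^\vee,x\rangle\ge 0\ \forall t\}$. A facet of an $e$-alcove is a codimension-one face of its closure. The alcove $\mathcal{A}_\mu$. For $\mu\in\Gamma_r(w)$ let $S_\mu$ be the set of all $\Omega(\lambda)$, where $\lambda$ ranges over partitions with at most $r$ parts whose $e$-abacus with $r$ beads has exactly one bead on each of $r$ runners $s_1<\cdots<s_r$ (any choice of such runners), the bead on runner $s_t$ being in row $\mu_t$. The set $S_\mu$ is exactly the set of all weights of $P$ lying in one dominant $e$-alcove; this $e$-alcove is denoted $\mathcal{A}_\mu$. *)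

(* Defs.v *)
From HB Require Import structures.
From mathcomp Require Import all_boot all_order all_algebra.
From mathcomp Require Import all_classical all_reals all_analysis.

Set Implicit Arguments.
Unset Strict Implicit.
Unset Printing Implicit Defensive.

Import Order.TTheory GRing.Theory Num.Theory.
Import numFieldNormedType.Exports.

Local Open Scope classical_set_scope.
Local Open Scope ring_scope.

(* A sequence (mu_1, ..., mu_r) is a tuple, so that mu_t is [nth 0 mu t.-1]. *)
Definition weak_composition (r w : nat) : pred (r.-tuple nat) :=
  fun mu => sumn mu == w.

Definition swap_adjacent (r i : nat) (mu : r.-tuple nat) : r.-tuple nat :=
  [tuple nth 0%N mu
     (if j == i.-1 :> nat then i else if j == i :> nat then i.-1 else j) | j < r].

Definition affine_swap (r : nat) (mu : r.-tuple nat) : r.-tuple nat :=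
  [tuple if j == 0%N :> nat then (nth 0%N mu r.-1).+1
         else if j == r.-1 :> nat then (nth 0%N mu 0%N).-1
         else nth 0%N mu j | j < r].

(* [None] means that mu sigma_i is undefined. *)
Definition sigma_act (r i : nat) (mu : r.-tuple nat) : option (r.-tuple nat) :=
  if i == 0%N then (if (0 < nth 0%N mu 0%N)%N then Some (affine_swap mu) else None)
  else Some (swap_adjacent i mu).

(* Trailing zeros are not stored, so the number of parts is the size. *)
Definition is_partition (lam : seq nat) : bool :=
  sorted geq lam && (0%N \notin lam).

(* beta_t for 1 <= t <= r; [nth] supplies the padding by zeros. *)
Definition beta (r : nat) (lam : seq nat) (t : nat) : nat :=
  (nth 0 lam t.-1 + (r - t))%N.

Definition has_bead (e r : nat) (lam : seq nat) (row runner : nat) : Prop :=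
  exists t : nat, [/\ (1 <= t <= r)%N,
    (beta r lam t %/ e)%N = row & (beta r lam t %% e)%N = runner].

Definition abacus_type (e r : nat) (mu : r.-tuple nat) (lam : seq nat) : Prop :=
  exists s : r.-tuple nat,
    [/\ sorted ltn s, all (fun b => b < e)%N s &
      forall (t : 'I_r) (row : nat),
        has_bead e r lam row (tnth s t) <-> row = tnth mu t].

Section Geometry.
Variables (R : realType) (r : nat).
Local Notation V := 'rV[R]_r.

Definition dot (x y : V) : R := \sum_(j < r) x 0 j * y 0 j.

Definition sum_zero : set V := [set x | \sum_(j < r) x 0 j = 0].

(* epsilon_s - epsilon_t; it is equal to its own coroot. *)
Definition pos_root (s t : 'I_r) : V := delta_mx 0 s - delta_mx 0 t.

(* Lambda_t for 1 <= t <= r - 1: the projection of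
   epsilon_1 + ... + epsilon_t to the sum-zero hyperplane. *)
Definition fund_weight (t : nat) : V :=
  \row_(j < r) ((j < t)%N%:R - t%:R / r%:R).

Lemma dot_pos_rootE (s t : 'I_r) (x : V) : dot (pos_root s t) x = x 0 s - x 0 t.
Proof.
rewrite /dot (eq_bigr (fun j => (j == s)%:R * x 0 j - (j == t)%:R * x 0 j)).
  rewrite big_split/= sumrN (bigD1 s)//= eqxx mul1r big1 ?addr0; last first.
    by move=> j /negPf ->; rewrite mul0r.
  rewrite (bigD1 t)//= eqxx mul1r big1 ?addr0// => j /negPf ->.
  by rewrite mul0r.
by move=> j _; rewrite !mxE !eqxx !andTb mulrBl.
Qed.

(* The simple root alpha_k is pos_root s t with s = k - 1 and t = k, since the
   ordinals indexing the coordinates start at 0. *)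
Lemma dot_simple_root_fund_weight (s t : 'I_r) (k : nat) :
  t = s.+1 :> nat -> dot (pos_root s t) (fund_weight k) = (t == k :> nat)%:R.
Proof.
move=> ts; rewrite dot_pos_rootE !mxE opprB addrA subrK ts.
by case: (ltngtP s.+1 k) => _; rewrite ?subrr ?subr0.
Qed.

Lemma fund_weight_sum_zero (t : nat) : (t < r)%N -> sum_zero (fund_weight t).
Proof.
move=> tr; rewrite /sum_zero /=.
under eq_bigr do rewrite mxE.
have r0 : r%:R != 0 :> R by rewrite pnatr_eq0 -lt0n (leq_ltn_trans _ tr).
rewrite big_split/= sumr_const card_ord -[(- _) *+ _]mulr_natr mulNr divfK//.
rewrite -natr_sum -(big_mkord xpredT (fun j => (j < t)%N : nat)).
rewrite (big_cat_nat (n := t))//=; last exact: ltnW.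
rewrite [X in (_ + X)%N]big_nat [X in (_ + X)%N]big1; last first.
  by move=> j /andP[tj _]; rewrite ltnNge tj.
rewrite addn0 big_nat (eq_bigr (fun=> 1%N)); last by move=> j /andP[_ ->].
by rewrite -big_nat sum_nat_const_nat muln1 subn0 subrr.
Qed.

Definition weight_lattice : set V :=
  [set x | exists c : nat -> int,
     x = \sum_(1 <= t < r) (c t)%:~R *: fund_weight t].

Definition Omega (lam : seq nat) : V :=
  \sum_(1 <= t < r)
     ((beta r lam t)%:R - (beta r lam t.+1)%:R) *: fund_weight t.

Definition root_hyperplane (e : nat) (s t : 'I_r) (k : int) : set V :=
  [set x | sum_zero x /\ dot (pos_root s t) x = k%:~R * e%:R].

Definition hyperplane_complement (e : nat) : set V :=
  sum_zero `\`
  [set x | exists s t : 'I_r, (s < t)%N /\ exists k, root_hyperplane e s t k x].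

Definition is_alcove (e : nat) (A : set V) : Prop :=
  exists2 x, hyperplane_complement e x &
    A = connected_component (hyperplane_complement e) x.

Definition dominant (A : set V) : Prop :=
  forall x, A x ->
    forall s t : 'I_r, t = s.+1 :> nat -> 0 <= dot (pos_root s t) x.

Definition aff_dim (F : set V) (d : nat) : Prop :=
  exists2 p, F p & exists D : 'M[R]_(d, r),
    [/\ row_free D, forall k, F (p + row k D) &
        forall x, F x -> (x - p <= D)%MS].

Definition is_face (K F : set V) : Prop :=
  exists (u : V) (c : R), (forall x, K x -> dot u x <= c) /\
    F = [set x | K x /\ dot u x = c].

Definition is_facet (A F : set V) : Prop :=
  is_face (closure A) F /\
  exists d, aff_dim F d /\ aff_dim (closure A) d.+1.

Definition have_common_facet (A B : set V) : Prop :=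
  exists F, is_facet A F /\ is_facet B F.

Definition S_weights (e : nat) (mu : r.-tuple nat) : set V :=
  [set Omega lam | lam in
     [set lam | [/\ is_partition lam, (size lam <= r)%N &
                    abacus_type e mu lam]]].

Definition is_alcove_of (e : nat) (mu : r.-tuple nat) (A : set V) : Prop :=
  [/\ is_alcove e A, dominant A & A `&` weight_lattice = S_weights e mu].

(* The default value is the empty set, which has no facet.  For e >= r the
   set S_mu is not empty, so at most one alcove satisfies [is_alcove_of]. *)
Definition alcove_of (e : nat) (mu : r.-tuple nat) : set V :=
  xget set0 (is_alcove_of e mu).

End Geometry.

Arguments alcove_of R {r} e mu.

(* Main.v *)
(* A point x of E is described by the r cyclic gaps between the reduced numbers
   y_t = x_(p t) - mu_t e, where p t is the position of the bead of runner s_t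
   among the decreasingly ordered beads: gap_t = y_(t+1) - y_t, and the last gap
   is y_1 + e - y_r. The gaps sum to e, and A_mu is the open simplex on which all
   of them are positive, since y_t = s_t up to a common constant when
   x = Omega(lambda). Ordering the beads amounts to ordering the keys
   mu_t r + t; sigma_i exchanges two cyclically consecutive runners a, b while
   changing their keys by one only, so it composes p with the transposition
   (a b) unless it fixes mu. The new gap at a is then the opposite of the old
   one, and on the wall where it vanishes all the y_t, hence all gaps, are
   unchanged: this wall is the common facet. *)

Require Import Defs.
From HB Require Import structures.
From mathcomp Require Import all_boot all_order all_algebra.
From mathcomp Require Import all_classical all_reals all_analysis.
From mathcomp Require Import fingroup perm zify ring lra.

Set Implicit Arguments.
Unset Strict Implicit.
Unset Printing Implicit Defensive.

Import Order.TTheory GRing.Theory Num.Theory.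
Import numFieldNormedType.Exports.

Local Open Scope classical_set_scope.
Local Open Scope ring_scope.

(** * Coordinate differences on the sum-zero hyperplane; the weight lattice *)

Section SumZero.
Variables (R : realType) (r : nat).
Implicit Types (x : 'rV[R]_r) (f : 'I_r -> R).

(** The projection along the all-ones vector. A point of the hyperplane is determined by its
    coordinate differences, so identities are checked on differences. *)
Definition recenter f : 'rV[R]_r := \row_j (f j - (\sum_k f k) / r%:R).

Lemma recenter_sum_zero f : sum_zero (recenter f).
Proof.
rewrite /sum_zero /=; under eq_bigr do rewrite mxE.
case: r f => [f|k f]; first by rewrite big_ord0.
by rewrite sumrB sumr_const card_ord -[_ *+ _]mulr_natr divfK ?subrr.
Qed.

Lemma recenterP x f : sum_zero x ->
  (forall j k, x 0 j - x 0 k = f j - f k) -> x = recenter f.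
Proof.
move=> x0 xf; apply/rowP => j; rewrite mxE.
have r0 : r%:R != 0 :> R by rewrite pnatr_eq0 -lt0n (leq_ltn_trans _ (ltn_ord j)).
have : \sum_k (x 0 j - x 0 k) = \sum_k (f j - f k).
  by apply: eq_bigr => k _; rewrite xf.
move: x0; rewrite [LHS]sumrB [RHS]sumrB /sum_zero /= => ->.
rewrite subr0 [LHS]sumr_const [X in _ = X - _]sumr_const card_ord.
rewrite -[x 0 j *+ r]mulr_natr -[f j *+ r]mulr_natr => h.
by apply: (mulIf r0); rewrite h mulrBl divfK.
Qed.

Lemma recenter_sub f j k : recenter f 0 j - recenter f 0 k = f j - f k.
Proof. by rewrite !mxE; ring. Qed.

Lemma sum_zero_inj x y : sum_zero x -> sum_zero y ->
  (forall j k, x 0 j - x 0 k = y 0 j - y 0 k) -> x = y.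
Proof.
by move=> x0 y0 xy; rewrite (recenterP x0 xy) -(@recenterP y _ y0).
Qed.

Lemma sum_zeroD x y : sum_zero x -> sum_zero y -> sum_zero (x + y).
Proof.
rewrite /sum_zero /= => x0 y0; under eq_bigr do rewrite mxE.
by rewrite big_split /= x0 y0 addr0.
Qed.

Lemma sum_zeroZ c x : sum_zero x -> sum_zero (c *: x).
Proof.
rewrite /sum_zero /= => x0; under eq_bigr do rewrite mxE.
by rewrite -mulr_sumr x0 mulr0.
Qed.

Lemma sum_zeroB x y : sum_zero x -> sum_zero y -> sum_zero (x - y).
Proof.
by move=> x0 y0; rewrite -scaleN1r; apply: sum_zeroD => //; apply: sum_zeroZ.
Qed.

Lemma sum_zero_sum (I : Type) (s : seq I) (F : I -> 'rV[R]_r) :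
  (forall i, sum_zero (F i)) -> sum_zero (\sum_(i <- s) F i).
Proof.
move=> F0; elim/big_ind : _ => [|x y|//]; last exact: sum_zeroD.
by rewrite /sum_zero /=; under eq_bigr do rewrite mxE; rewrite big1.
Qed.

(* Summation by parts. *)
Lemma fund_weight_sumE (f : nat -> R) :
  \sum_(1 <= t < r) (f t.-1 - f t) *: fund_weight R r t =
  recenter (fun j => f j).
Proof.
apply: recenterP => [|j k].
  rewrite big_nat; elim/big_ind : _ => [|x y|t /andP[_ tr]].
  - by rewrite /sum_zero /=; under eq_bigr do rewrite mxE; rewrite big1.
  - exact: sum_zeroD.
  - exact/sum_zeroZ/fund_weight_sum_zero.
(* The part of [fund_weight] that does not depend on the coordinate gives a constant; the rest
   telescopes over [i < t < r]. *)
have E (i : 'I_r) : (\sum_(1 <= t < r) (f t.-1 - f t) *: fund_weight R r t) 0 i =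
    f i - f r.-1 - \sum_(1 <= t < r) (f t.-1 - f t) * (t%:R / r%:R).
  rewrite summxE (eq_bigr (fun t => (f t.-1 - f t) * (i < t)%:R -
     (f t.-1 - f t) * (t%:R / r%:R))); last first.
    by move=> t _; rewrite !mxE mulrBr.
  rewrite sumrB; congr (_ - _).
  rewrite (big_cat_nat (n := i.+1)) //= big_nat big1 ?add0r; last first.
    by move=> t; rewrite ltnS => /andP[_ ti]; rewrite ltnNge ti mulr0.
  rewrite big_nat (eq_bigr (fun t => - (f t - f t.-1))); last first.
    by move=> t /andP[-> _]; rewrite mulr1 opprB.
  rewrite -big_nat sumrN big_add1 telescope_sumr ?opprB//.
  by have := ltn_ord i; lia.
by rewrite !E; ring.
Qed.

Lemma Omega_recenter lam :
  Omega R r lam = recenter (fun j => (beta r lam j.+1)%:R).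
Proof.
rewrite -(fund_weight_sumE (fun j => (beta r lam j.+1)%:R)) /Omega.
rewrite !big_nat; apply: eq_bigr => t /andP[t0 _].
by rewrite prednK.
Qed.

(** The coefficients along the fundamental weights are the differences of consecutive coordinates,
    and these generate all differences. *)
Lemma weight_latticeP x : weight_lattice x <->
  sum_zero x /\ forall j k, x 0 j - x 0 k \is a Num.int.
Proof.
split=> [[c ->]|[x0 xint]].
  (* Minus the partial sums of [c], so that [f t.-1 - f t] is [c t]. *)
  pose f k : R := - \sum_(1 <= t < k.+1) (c t)%:~R.
  have -> : \sum_(1 <= t < r) (c t)%:~R *: fund_weight R r t =
      \sum_(1 <= t < r) (f t.-1 - f t) *: fund_weight R r t.
    rewrite !big_nat; apply: eq_bigr => t /andP[t0 _]; congr (_ *: _).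
    by rewrite /f prednK// (big_nat_recr t)//=; ring.
  rewrite fund_weight_sumE; split=> [|j k]; first exact: recenter_sum_zero.
  rewrite recenter_sub /f rpredB// rpredN rpred_sum// => t _; exact: intr_int.
pose f k := if insub k is Some j then x 0 j else 0.
have fE (j : 'I_r) : f j = x 0 j by rewrite /f valK.
exists (fun t => Num.floor (f t.-1 - f t)).
rewrite (@recenterP x (fun j => f j))//; last by move=> j k; rewrite !fE.
rewrite -fund_weight_sumE !big_nat; apply: eq_bigr => t /andP[t0 tr].
have tr' : (t.-1 < r)%N by lia.
have -> : f t.-1 = x 0 (Ordinal tr') := fE (Ordinal tr').
have -> : f t = x 0 (Ordinal tr) := fE (Ordinal tr).
by rewrite floorK.
Qed.

End SumZero.

(** * Cyclic gaps as barycentric coordinates; the open simplex, its closure and its faces *)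

Section Gaps.
Variables (R : realType) (n e : nat) (m : 'I_n.+2 -> nat) (p : {perm 'I_n.+2}).
Local Notation V := 'rV[R]_n.+2.
Implicit Types (x y w : V) (t u : 'I_n.+2).

Definition level x t : R := x 0 (p t) - (m t * e)%:R.

Definition gap x t : R :=
  level x (ordS t) - level x t + (if ordS t == ord0 then e%:R else 0).

(** The linear part of the affine function [gap]. *)
Definition lgap w t : R := w 0 (p (ordS t)) - w 0 (p t).

Lemma gapB x y t : gap x t - gap y t = lgap (x - y) t.
Proof. by rewrite /gap /level /lgap !mxE; ring. Qed.

Lemma lgap_sum (I : Type) (s : seq I) (c : I -> R) (F : I -> V) t :
  lgap (\sum_(i <- s) c i *: F i) t = \sum_(i <- s) c i * lgap (F i) t.
Proof.
rewrite /lgap !summxE -sumrB; apply: eq_bigr => i _.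
by rewrite !mxE mulrBr.
Qed.

Lemma ordS_val t : ordS t = (if t == n.+1 :> nat then 0 else t.+1)%N :> nat.
Proof.
rewrite /=; case: eqP => [->|/eqP tn]; first by rewrite modnn.
by rewrite modn_small//; have := ltn_ord t; lia.
Qed.

Lemma ordS_eq0 t : (ordS t == ord0) = (t == n.+1 :> nat).
Proof. by rewrite -(inj_eq (@ord_inj _)) ordS_val; case: ifP. Qed.

Lemma lgap_inj w : sum_zero w -> (forall t, lgap w t = 0) -> w = 0.
Proof.
move=> w0 lw0.
have H k : (k < n.+2)%N -> w 0 (p (inord k)) = w 0 (p ord0).
  elim: k => [|k IH] kn; first by congr (w 0 (p _)); apply/val_inj; rewrite /= inordK.
  have /eqP := lw0 (inord k); rewrite subr_eq0 => /eqP.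
  rewrite IH; last lia.
  move=> <-; congr (w 0 (p _)); apply/ord_inj.
  by rewrite ordS_val !inordK//; last exact: ltnW; case: eqP => //; lia.
have K j : w 0 j = w 0 (p ord0).
  rewrite -[j](permKV p) -(H ((p^-1)%g j)) ?ltn_ord//.
  by rewrite inord_val.
apply: sum_zero_inj => // [|j k]; first by rewrite /sum_zero /= big1// => i _; rewrite mxE.
by rewrite K [w 0 k]K !mxE !subrr.
Qed.

(** The level differences cancel around the cycle; only the [e] of the closing gap remains. *)
Lemma sum_gap x : \sum_t gap x t = e%:R.
Proof.
have reindex_ordS (F : 'I_n.+2 -> R) : \sum_t F (ordS t) = \sum_t F t.
  by rewrite [RHS](reindex_inj (@ordS_inj _)).
rewrite /gap big_split sumrB /= (reindex_ordS (level x)) subrr add0r.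
rewrite (reindex_ordS (fun t => if t == ord0 then e%:R else 0)).
by rewrite -big_mkcond /= big_pred1_eq.
Qed.

(** All gaps but the last say that the levels increase; the closing gap says that the last level
    stays below the first plus [e]. *)
Lemma gap_gt0P x : (forall t, 0 < gap x t) <->
  forall t u, (t < u)%N -> level x t < level x u < level x t + e%:R.
Proof.
split=> [g0 t u tu|H t].
  have step k : (k.+1 < n.+2)%N -> level x (inord k) < level x (inord k.+1).
    move=> kn; have := g0 (inord k); rewrite /gap ordS_eq0 inordK ?(ltnW kn)//.
    have -> : ordS (inord k) = inord k.+1 :> 'I_n.+2.
      apply/ord_inj; rewrite ordS_val !inordK//; last lia.
      by case: eqP => //; lia.
    by case: eqP => [|_]; [lia|rewrite addr0 subr_gt0].
  have mono a b : (a < b)%N -> (b < n.+2)%N -> level x (inord a) < level x (inord b).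
    elim: b => // b IH; rewrite ltnS leq_eqVlt => /orP[/eqP-> /step//|ab bn].
    by apply: lt_trans (IH ab (ltnW bn)) (step _ bn).
  have le a b : (a <= b)%N -> (b < n.+2)%N -> level x (inord a) <= level x (inord b).
    rewrite leq_eqVlt => /orP[/eqP->//|ab bn]; exact/ltW/mono.
  rewrite -[t]inord_val -[u]inord_val mono//=.
  have := g0 ord_max; rewrite /gap ordS_eq0 eqxx.
  have -> : ordS ord_max = inord 0 :> 'I_n.+2.
    apply/ord_inj; rewrite ordS_val inordK//=.
    by rewrite eqxx.
  have -> : ord_max = inord n.+1 :> 'I_n.+2 by apply/ord_inj; rewrite inordK.
  have := le 0%N t (leq0n _) (ltn_ord t).
  have := le u n.+1 _ (ltnSn _); rewrite -ltnS ltn_ord => /(_ isT); lra.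
rewrite /gap ordS_eq0; case: eqP => tn.
  have -> : ordS t = ord0 by apply/eqP; rewrite ordS_eq0 tn.
  have := H ord0 t; rewrite tn => /(_ isT); lra.
have := H t (ordS t); rewrite ordS_val; case: eqP => // _ /(_ (ltnSn _)); lra.
Qed.

(** The levels are 0 up to index [u] and [e] beyond it, up to a common constant, so the only jump
    around the cycle is at [u]. *)
Definition vertex u : V :=
  recenter (fun j => let t := (p^-1)%g j in
    (m t * e)%:R + (if (u < t)%N then e%:R else 0)).

Lemma gap_vertex u t : gap (vertex u) t = if t == u then e%:R else 0.
Proof.
have E a b : level (vertex u) a - level (vertex u) b =
    (if (u < a)%N then e%:R else 0) - (if (u < b)%N then e%:R else 0).
  by rewrite /level !mxE /= !permK; move: (_ / _) => c; do 2![case: ifP => _]; ring.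
rewrite /gap E ordS_eq0 ordS_val -[t == u](inj_eq (@ord_inj _)).
have un := ltn_ord u; case: (t =P n.+1 :> nat) => [->|_].
  by rewrite ltn0; case: (ltngtP u n.+1) => h; [ring|lia|ring].
by rewrite ltnS; case: (ltngtP u t) => h; ring.
Qed.

Lemma vertex_sum_zero u : sum_zero (vertex u).
Proof. exact: recenter_sum_zero. Qed.

(** The numbers [gap x u / e] sum to 1 and are the barycentric coordinates with respect to the
    vertices: both sides have the same linear gaps, which determine a vector of the hyperplane. *)
Lemma gap_barycentric q x : (0 < e)%N -> sum_zero x ->
  x - vertex q = \sum_u (gap x u / e%:R) *: (vertex u - vertex q).
Proof.
move=> e0 x0; have eR : e%:R != 0 :> R by rewrite pnatr_eq0 -lt0n.
apply/eqP; rewrite -subr_eq0; apply/eqP/lgap_inj.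
  apply: sum_zeroB; first exact/sum_zeroB/vertex_sum_zero.
  by apply: sum_zero_sum => u; apply/sum_zeroZ/sum_zeroB; exact: vertex_sum_zero.
move=> t; set S := \sum_u _.
have lB y z : lgap (y - z) t = lgap y t - lgap z t.
  by rewrite /lgap !mxE; ring.
rewrite lB -gapB /S lgap_sum.
under eq_bigr do rewrite -gapB !gap_vertex mulrBr.
rewrite sumrB -mulr_suml -mulr_suml sum_gap mulfV// mul1r gap_vertex.
rewrite (bigD1 t)//= eqxx divfK// big1 ?addr0 ?subrr// => u /negPf.
by rewrite eq_sym => ->; rewrite mulr0.
Qed.

(** This is the face spanned by the vertices [f k], with [f ord0] as base point. The linear gap at
    [f (lift ord0 k)] isolates the k-th coefficient, whence independence; barycentric coordinates
    give the span. *)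
Lemma face_aff_dim d (f : 'I_d.+1 -> 'I_n.+2) : (0 < e)%N -> injective f ->
  aff_dim [set x | [/\ sum_zero x, forall t, 0 <= gap x t &
    forall t, t \notin codom f -> gap x t = 0]] d.
Proof.
move=> e0 finj; have eR : e%:R != 0 :> R by rewrite pnatr_eq0 -lt0n.
have Fv k : [set x | [/\ sum_zero x, forall t, 0 <= gap x t &
    forall t, t \notin codom f -> gap x t = 0]] (vertex (f k)).
  split=> [|t|t tf]; [exact: vertex_sum_zero| |]; rewrite gap_vertex.
    by case: eqP => // _; rewrite ler0n.
  by case: eqP tf => // ->; rewrite codom_f.
pose D : 'M[R]_(d, n.+2) := \matrix_k (vertex (f (lift ord0 k)) - vertex (f ord0)).
exists (vertex (f ord0)) => //; exists D; split.
- apply: inj_row_free => v vD; apply/rowP => k; rewrite mxE.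
  have : lgap (\sum_k v 0 k *: row k D) (f (lift ord0 k)) = 0.
    by rewrite -mulmx_sum_row vD /lgap !mxE subrr.
  rewrite lgap_sum (bigD1 k)//= big1 => [|k' k'k]; rewrite rowK -gapB !gap_vertex.
    rewrite eqxx (inj_eq finj) subr0 addr0 => /eqP.
    by rewrite mulf_eq0 (negPf eR) orbF => /eqP.
  rewrite !(inj_eq finj) (inj_eq lift_inj) eq_sym (negPf k'k) /=.
  by rewrite subr0 mulr0.
- by move=> k; rewrite rowK addrC subrK; exact: Fv.
- move=> x [x0 _ xf]; rewrite (gap_barycentric (f ord0))//.
  apply: summx_sub => u _; have [/codomP[k ->]|uf] := boolP (u \in codom f).
    case: (unliftP ord0 k) => [k' ->|->]; last by rewrite subrr scaler0 sub0mx.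
    apply: scalemx_sub; rewrite -(rowK (fun k => vertex (f (lift ord0 k)) - vertex (f ord0))).
    exact: row_sub.
  by rewrite xf// mul0r scale0r sub0mx.
Qed.

Definition alcove_set : set V := [set x | sum_zero x /\ forall t, 0 < gap x t].

(** A lattice point rather than the barycenter: the gaps are 1 except the closing one, which is
    [e - n.+1]. This is positive when [e] is at least the number of runners. *)
Definition alcove_center : V :=
  recenter (fun j => let t := (p^-1)%g j in (m t * e)%:R + t%:R).

Lemma level_center t u :
  level alcove_center t - level alcove_center u = t%:R - u%:R.
Proof.
by rewrite /level !mxE /= !permK; move: (_ / _) => c; ring.
Qed.

Lemma alcove_set_center : (n.+2 <= e)%N -> alcove_set alcove_center.
Proof.
move=> ne; split; first exact: recenter_sum_zero.
apply/gap_gt0P => t u tu; have := level_center u t.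
have h1 : t%:R < u%:R :> R by rewrite ltr_nat.
have h2 : u%:R < t%:R + e%:R :> R.
  by rewrite -natrD ltr_nat; have := ltn_ord u; lia.
lra.
Qed.

Lemma gap_line x y (c : R) t :
  gap (x + c *: (y - x)) t = (1 - c) * gap x t + c * gap y t.
Proof. by rewrite /gap /level !mxE; ring. Qed.

Lemma line_continuous x y : continuous (fun c : R => x + c *: (y - x)).
Proof.
move=> c; apply: cvgD; first exact: cvg_cst.
apply: cvgZr_tmp; exact: cvg_id.
Qed.

Lemma coord_sub_continuous (s t : 'I_n.+2) (c : R) :
  continuous (fun x : V => x 0 s - x 0 t - c).
Proof.
move=> x; apply: (@cvgB _ _ _ (nbhs x)); last exact: cvg_cst.
by apply: (@cvgB _ _ _ (nbhs x));
  [exact: (@coord_continuous R 1 _ 0 s)|exact: (@coord_continuous R 1 _ 0 t)].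
Qed.

Lemma gap_continuous t : continuous (gap^~ t).
Proof.
have -> : gap^~ t = (fun x : V => x 0 (p (ordS t)) - x 0 (p t) -
    ((m (ordS t) * e)%:R - (m t * e)%:R - if ordS t == ord0 then e%:R else 0)).
  by apply/funext => x; rewrite /gap /level; case: ifP => _; ring.
exact: coord_sub_continuous.
Qed.

Lemma closed_sum_zero : closed (@sum_zero R n.+2).
Proof.
apply: (@preimage_closed _ _ (fun x : V => \sum_j x 0 j) [set 0]).
  move=> x _; apply: continuous_big => [|j _]; first exact: add_continuous.
  exact: (@coord_continuous R 1 _ 0 j).
exact: closed_eq.
Qed.

Lemma closure_alcove_set : (n.+2 <= e)%N ->
  closure alcove_set = [set x | sum_zero x /\ forall t, 0 <= gap x t].
Proof.
move=> ne; apply/seteqP; split.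
  have cl : closed [set x | sum_zero x /\ forall t, 0 <= gap x t].
    have -> : [set x | sum_zero x /\ forall t, 0 <= gap x t] =
       @sum_zero R n.+2 `&` \bigcap_t ((gap^~ t) @^-1` [set z | 0 <= z]).
      by apply/seteqP; split=> x [x0 xg]; split => // t *; exact: xg.
    apply: closedI; first exact: closed_sum_zero.
    apply: closed_bigI => t _; apply: preimage_closed; last exact: closed_ge.
    by move=> y _; exact: gap_continuous.
  rewrite [X in _ `<=` X](iffLR (closure_id _) cl); apply: closure_subset => x [x0 xg].
  by split=> // t; exact/ltW.
(* A point with non-negative gaps is approached along the segment to [alcove_center], on which the
   gaps become positive at once. *)
move=> x [x0 xg] U xU.
have [y0 yg] := alcove_set_center ne; set y := alcove_center in y0 yg.
have : nbhs (0 : R) ((fun c : R => x + c *: (y - x)) @^-1` U).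
  by apply: line_continuous; rewrite /= scale0r addr0.
move=> /nbhs_ballP[d /= d0 dU].
(* Below [d] to stay in the neighbourhood, and at most 1 to stay on the segment. *)
pose c : R := Num.min (d / 2) 1.
have c0 : 0 < c by rewrite lt_min ltr01 divr_gt0.
exists (x + c *: (y - x)); split.
  split; first by apply: sum_zeroD => //; exact/sum_zeroZ/sum_zeroB.
  move=> t; rewrite gap_line ltr_wpDl ?mulr_gt0// mulr_ge0 ?subr_ge0//.
  by rewrite ge_min lexx orbT.
apply: dU; rewrite /ball /= sub0r normrN gtr0_norm//.
rewrite gt_min; apply/orP; left; lra.
Qed.

Lemma alcove_set_connected x : alcove_set x -> connected alcove_set.
Proof.
move=> [x0 xg].
(* By convexity the set is the union of the segments issuing from [x]. *)
have -> : alcove_set = \bigcup_(y in alcove_set)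
    [set x + c *: (y - x) | c in `[0, 1]%classic].
  apply/seteqP; split=> [y yA|z [y [y0 yg] [c /=]]].
    exists y => //; exists 1; last by rewrite scale1r addrC subrK.
    by rewrite /= in_itv /= ler01 lexx.
  rewrite in_itv /= => /andP[c0 c1] <-; split.
    by apply: sum_zeroD => //; exact/sum_zeroZ/sum_zeroB.
  move=> t; rewrite gap_line; have := xg t; have := yg t => gy gx.
  have [->|c1'] := eqVneq c 1; first by rewrite subrr mul0r add0r mul1r.
  by rewrite ltr_pwDl ?mulr_ge0 ?(ltW gy)// mulr_gt0// subr_gt0 lt_neqAle c1'.
apply: bigcup_connected => [|y yA].
  exists x => y yA; exists 0; last by rewrite scale0r addr0.
  by rewrite /= in_itv /= lexx ler01.
apply: connected_continuous_connected; first exact: segment_connected.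
by apply: continuous_subspaceT; exact: line_continuous.
Qed.

End Gaps.

(** * The permutation that sorts the beads *)

Section Sorting.
Variables (n : nat) (m : 'I_n.+2 -> nat).
Implicit Types (t u : 'I_n.+2) (p q : {perm 'I_n.+2}).

(** The lexicographic order of row, then runner, encoded in one integer; this is possible because
    [t < n.+2]. *)
Definition key t : nat := (m t * n.+2 + t)%N.

Definition sorts p : Prop := forall t u, (key t < key u)%N -> (p u < p t)%N.

Lemma ltn_keyE t u :
  (key t < key u)%N = (m t < m u)%N || ((m t == m u) && (t < u)%N).
Proof.
have := ltn_ord t; have := ltn_ord u; rewrite /key => un tn.
case: (ltngtP (m t) (m u)) => h /=; [nia|nia|].
by rewrite h ltn_add2l.
Qed.

Lemma key_inj : injective key.
Proof.
move=> t u tu; have := ltnn (key t); rewrite {2}tu ltn_keyE => tu'.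
have := ltnn (key t); rewrite {1}tu ltn_keyE => ut'.
by apply/ord_inj; lia.
Qed.

Lemma sortsE p t u : sorts p -> (p u < p t)%N = (key t < key u)%N.
Proof.
move=> ps; apply/idP/idP => [|/ps//]; apply: contraTT; rewrite -!leqNgt.
rewrite leq_eqVlt => /orP[/eqP/key_inj->//|/ps/ltnW//].
Qed.

(** The positions before [p t] are occupied exactly by the indices of larger key. This count does
    not involve [p], which yields uniqueness and, conversely, a construction. *)
Lemma sorts_rank p t : sorts p -> p t = #|[pred u | (key t < key u)%N]| :> nat.
Proof.
move=> ps; rewrite -[LHS](card_ord (p t)).
rewrite -(card_codom (f := fun i : 'I_(p t) => (p^-1)%g (widen_ord (ltnW (ltn_ord (p t))) i))).
  apply: eq_card => u; rewrite inE -(sortsE _ _ ps); apply/codomP/idP => [[i ->]|h].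
    by rewrite permKV /=.
  by exists (Ordinal h); apply: (@perm_inj _ p); rewrite permKV; exact/ord_inj.
by move=> i j /perm_inj/(congr1 val)/= h; exact/ord_inj.
Qed.

Lemma sorts_unique p q : sorts p -> sorts q -> p = q.
Proof.
by move=> ps qs; apply/permP => t; apply/ord_inj; rewrite !sorts_rank.
Qed.

Lemma exists_sorts : exists p, sorts p.
Proof.
have rk t : (#|[pred u | (key t < key u)%N]| < n.+2)%N.
  rewrite -[X in (_ < X)%N]card_ord; apply: proper_card; apply/properP; split.
    exact/fintype.subsetP.
  by exists t; rewrite // inE ltnn.
have mono t u : (key t < key u)%N -> (Ordinal (rk u) < Ordinal (rk t))%N.
  move=> tu /=; apply: proper_card; apply/properP; split.
    by apply/fintype.subsetP => v; rewrite !inE; exact: ltn_trans.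
  by exists u; rewrite !inE ?tu ?ltnn.
have inj : injective (fun t => Ordinal (rk t)).
  move=> t u h; apply: key_inj; case: (ltngtP (key t) (key u)) => // /mono.
    by rewrite h ltnn.
  by rewrite h ltnn.
by exists (perm inj) => t u /mono; rewrite !permE.
Qed.

End Sorting.

(** * Partitions and strictly decreasing beta numbers *)

Section BetaNumbers.
Variable r : nat.

Lemma beta_decreasing lam (j k : 'I_r) : is_partition lam ->
  (j < k)%N -> (beta r lam k.+1 < beta r lam j.+1)%N.
Proof.
move=> /andP[lams _] jk; rewrite /beta /=.
suff : (nth 0 lam k <= nth 0 lam j)%N by have := ltn_ord k; lia.
have [sk|sk] := leqP (size lam) k; first by rewrite nth_default.
have geq_tr : transitive geq by move=> a b c /= ba cb; exact: leq_trans cb ba.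
by apply: (sorted_leq_nth geq_tr leqnn) => //; rewrite ?inE; lia.
Qed.

(** The zeros of a weakly decreasing sequence form a tail, which the default value of [nth] restores
    after their removal. *)
Lemma nth_filter_neq0 l i : sorted geq l ->
  nth 0%N [seq x <- l | x != 0%N] i = nth 0%N l i.
Proof.
have geq_tr : transitive geq by move=> a b c /= ba cb; exact: leq_trans cb ba.
elim: l i => // a l IH i; rewrite /= path_sortedE// => /andP[/allP al ls].
have [a0|a0] := eqVneq a 0%N; last by case: i => //= i; rewrite IH.
have l0 x : x \in l -> x = 0%N by move=> /al /=; rewrite a0 leqn0 => /eqP.
rewrite (_ : seq.filter _ _ = [::]).
  rewrite nth_nil a0; case: i => //= i.
  by have [/(mem_nth 0%N)/l0|/(nth_default 0%N)] := ltnP i (size l) => ->.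
by apply/eqP; rewrite -size_eq0 size_filter -leqn0 leqNgt -has_count; apply/hasP => -[x /l0->].
Qed.

Lemma partition_of_beta (b : 'I_r -> nat) :
  (forall j k : 'I_r, (j < k)%N -> (b k < b j)%N) ->
  exists lam, [/\ is_partition lam, (size lam <= r)%N &
    forall j : 'I_r, beta r lam j.+1 = b j].
Proof.
move=> bd.
pose g k := if insub k is Some j then (b j - (r - k.+1))%N else 0%N.
have gE (j : 'I_r) : g j = (b j - (r - j.+1))%N by rewrite /g valK.
(* Strict decrease, by induction from the last index upwards, makes the truncated subtraction in [g]
   exact. *)
have bge (j : 'I_r) : (r - j.+1 <= b j)%N.
  suff H d : forall j : 'I_r, (r - j.+1 = d)%N -> (d <= b j)%N by exact: H.
  elim: d => // d IH i ri.
  have i1 : (i.+1 < r)%N by lia.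
  have := bd i (Ordinal i1) (ltnSn _); have := IH (Ordinal i1).
  by rewrite /= => /(_ ltac:(lia)); lia.
have gs : sorted geq (mkseq g r).
  apply/(sortedP 0%N) => i; rewrite size_mkseq => ir.
  rewrite /= !nth_mkseq//; last lia.
  have -> := gE (Ordinal ir); have -> := gE (Ordinal (ltnW ir)).
  by have := bd (Ordinal (ltnW ir)) (Ordinal ir) (ltnSn _); rewrite /=; lia.
exists [seq x <- mkseq g r | x != 0%N]; split.
- apply/andP; split; last by rewrite mem_filter.
  by apply: sorted_filter => // a x c /= ba cb; exact: leq_trans cb ba.
- by rewrite size_filter (leq_trans (count_size _ _))// size_mkseq.
- move=> j; rewrite /beta /= nth_filter_neq0// nth_mkseq// gE.
  by have := bge j; lia.
Qed.

End BetaNumbers.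

(** * The open simplex is a dominant alcove *)

Section AlcoveOf.
Variables (R : realType) (n e : nat) (m : 'I_n.+2 -> nat) (p : {perm 'I_n.+2}).
Hypotheses (ne : (n.+2 <= e)%N) (ps : sorts m p).
Local Notation A := (alcove_set (R := R) e m p).

Lemma coord_sub_level (x : 'rV[R]_n.+2) t u :
  x 0 (p t) - x 0 (p u) =
  level e m p x t - level e m p x u + ((m t)%:R - (m u)%:R) * e%:R.
Proof. by rewrite /level !natrM; ring. Qed.

Lemma level_dist x t u : A x -> level e m p x t - level e m p x u < e%:R.
Proof.
move=> [_ /gap_gt0P H]; have eR : 0 < e%:R :> R by rewrite ltr0n; lia.
have [tu|ut|/ord_inj->] := ltngtP t u; last by rewrite subrr.
  by have := H t u tu; lra.
by have := H u t ut; lra.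
Qed.

(** A larger row contributes at least [e], which outweighs any difference of levels; in equal rows
    the levels themselves decide. *)
Lemma alcove_set_decreasing x (j k : 'I_n.+2) : A x -> (j < k)%N -> x 0 k < x 0 j.
Proof.
move=> Ax jk; rewrite -subr_gt0 -[j](permKV p) -[k](permKV p) coord_sub_level.
move: jk; rewrite -[j](permKV p) -[k](permKV p) (sortsE _ _ ps) !permK ltn_keyE.
set t := (p^-1)%g j; set u := (p^-1)%g k => /orP[mut|/andP[/eqP-> ut]].
  have := level_dist u t Ax; have : 1 <= (m t)%:R - (m u)%:R :> R.
    by rewrite lerBrDr nat1r ler_nat.
  have eR : 0 < e%:R :> R by rewrite ltr0n; lia.
  by move=> h1 h2; have := ler_wpM2r (ltW eR) h1; lra.
have [_ /gap_gt0P/(_ u t ut)] := Ax; lra.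
Qed.

Lemma alcove_set_dominant : dominant A.
Proof.
move=> x Ax s t ts; rewrite dot_pos_rootE subr_ge0; apply/ltW.
by apply: (alcove_set_decreasing Ax); rewrite ts.
Qed.

Lemma alcove_set_complement : A `<=` @hyperplane_complement R n.+2 e.
Proof.
have eR : 0 < e%:R :> R by rewrite ltr0n; lia.
move=> x Ax; split; first by case: Ax.
move=> [s [t [st [k [_]]]]]; rewrite dot_pos_rootE.
rewrite -[s](permKV p) -[t](permKV p) coord_sub_level.
set a := (p^-1)%g s; set b := (p^-1)%g t => h.
have ab : a != b by rewrite (inj_eq perm_inj); apply: contraTneq st => ->; rewrite ltnn.
(* On a root hyperplane a difference of two levels is [z] times [e]; it is smaller than [e] in
   absolute value, so the two levels agree, against their strict increase. *)
pose z : int := k - (m a)%:Z + (m b)%:Z.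
have hz : level e m p x a - level e m p x b = z%:~R * e%:R.
  by rewrite /z rmorphD rmorphB /= -!pmulrn; lra.
have z1 : (z < 1).
  by rewrite -(ltr_int R) -(ltr_pM2r eR) mul1r -hz; exact: level_dist.
have z2 : (- z < 1).
  rewrite -(ltr_int R) -(ltr_pM2r eR) mul1r rmorphN mulNr -hz opprB; exact: level_dist.
have z0 : z = 0 by lia.
move: hz; rewrite z0 mul0r => hz; case: Ax => _ /gap_gt0P H.
have [ab'|ab'|/ord_inj/eqP] := ltngtP a b; last by rewrite (negPf ab).
  by have := H _ _ ab'; lra.
by have := H _ _ ab'; lra.
Qed.

Lemma gap_neq0 x t : @hyperplane_complement R n.+2 e x -> gap e m p x t != 0.
Proof.
move=> [x0 xH]; apply: contra_notN xH => /eqP g0.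
pose k : int := (m (ordS t))%:Z - (m t)%:Z - (ordS t == ord0)%:Z.
have xk : x 0 (p (ordS t)) - x 0 (p t) = k%:~R * e%:R.
  rewrite coord_sub_level /k !rmorphB /= -!pmulrn.
  by move: g0; rewrite /gap; case: eqP => _; rewrite ?mulr1n ?mulr0n; lra.
(* Hyperplanes are indexed by positive roots only, so the two orders of these positions are treated
   separately. *)
have : p (ordS t) != p t.
  rewrite (inj_eq perm_inj); apply/eqP => /(congr1 (@nat_of_ord _)).
  by rewrite ordS_val; case: eqP; lia.
rewrite -(inj_eq (@ord_inj _)) neq_ltn => /orP[lt|lt].
  by exists (p (ordS t)), (p t); split=> //; exists k; split; rewrite // dot_pos_rootE.
exists (p t), (p (ordS t)); split=> //; exists (- k); split=> //.
by rewrite dot_pos_rootE rmorphN mulNr -xk opprB.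
Qed.

Lemma alcove_set_component x : A x ->
  A = connected_component (@hyperplane_complement R n.+2 e) x.
Proof.
move=> Ax; apply/seteqP; split.
  apply: connected_component_max => //; first exact: alcove_set_complement.
  exact: alcove_set_connected Ax.
move=> y Cy; have yH := connected_component_sub Cy.
split=> [|t]; first by case: yH.
(* A gap is continuous and never zero off the hyperplanes, so by the intermediate value theorem it
   keeps its sign on the component. *)
rewrite ltNge; apply/negP => g0.
have : is_interval [set gap e m p z t |
    z in connected_component (@hyperplane_complement R n.+2 e) x].
  apply/connected_intervalP/connected_continuous_connected.
    exact: component_connected.
  by apply: continuous_subspaceT; exact: gap_continuous.
move=> /(_ (gap e m p y t) (gap e m p x t)) /(_ _ _ 0) [].
- by exists y.
- by exists x => //; apply: connected_component_refl; exact: alcove_set_complement.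
- by rewrite g0 /=; apply/ltW; case: Ax => _; exact.
- by move=> z /connected_component_sub/(gap_neq0 t)/eqP.
Qed.

Lemma alcove_set_is_alcove : is_alcove e A.
Proof.
have Ac := alcove_set_center R m p ne.
by exists (alcove_center R e m p); [exact: alcove_set_complement|exact: alcove_set_component].
Qed.

Lemma alcove_center_lattice : weight_lattice (alcove_center R e m p).
Proof.
apply/weight_latticeP; split; first exact: recenter_sum_zero.
by move=> j k; rewrite recenter_sub /= rpredB// rpredD// ?natr_int.
Qed.

End AlcoveOf.

(** * The weights of the alcove are those of the abacus configurations *)

Section Weights.
Variables (R : realType) (n e : nat) (mu : n.+2.-tuple nat) (p : {perm 'I_n.+2}).
Hypotheses (ne : (n.+2 <= e)%N) (ps : sorts (tnth mu) p).
Local Notation A := (alcove_set (R := R) e (tnth mu) p).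

Lemma abacus_alcove_set lam : is_partition lam -> abacus_type e mu lam ->
  A (Omega R n.+2 lam).
Proof.
move=> lamP [s [ss se sb]]; rewrite Omega_recenter.
have eP : (0 < e)%N by lia.
have slt (t u : 'I_n.+2) : (t < u)%N -> (tnth s t < tnth s u)%N.
  move=> tu; rewrite !(tnth_nth 0%N); apply: (sorted_ltn_nth ltn_trans) => //.
    by rewrite inE size_tuple.
  by rewrite inE size_tuple.
have sinj t u : tnth s t = tnth s u -> t = u.
  move=> h; apply/ord_inj; have [/slt|/slt|//] := ltngtP t u; rewrite h ltnn//.
have slte t : (tnth s t < e)%N by move/allP: se => /(_ _ (mem_tnth t s)).
(* [q t] is the position of the bead on runner [s_t]. As the runners increase, the beads are ordered
   by their keys, so [q] is the sorting permutation [p]. *)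
have /fin_all_exists[q qP] : forall t, exists j : 'I_n.+2,
    beta n.+2 lam j.+1 = (tnth mu t * e + tnth s t)%N.
  move=> t; have [_ /(_ erefl)[k [/andP[k0 kr] <- <-]]] := sb t (tnth mu t).
  have k1 : (k.-1 < n.+2)%N by lia.
  by exists (Ordinal k1); rewrite /= prednK// -divn_eq.
have qinj : injective q.
  move=> t u qtu; apply: sinj; have := congr1 (modn^~ e) (qP t).
  by rewrite qtu qP !modnMDl !modn_small.
have qs : sorts (tnth mu) (perm qinj).
  move=> t u; rewrite !permE ltn_keyE => tu; rewrite ltnNge; apply/negP => qtu.
  have : (tnth mu t * e + tnth s t < tnth mu u * e + tnth s u)%N.
    have := slte t; case/orP: tu => [|/andP[/eqP-> /slt]]; nia.
  rewrite -!qP; move: qtu; rewrite leq_eqVlt => /orP[/eqP/ord_inj->|]; first by rewrite ltnn.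
  by move=> /(beta_decreasing lamP); lia.
rewrite (sorts_unique ps qs); split; first exact: recenter_sum_zero.
have lE t u : level e (tnth mu) (perm qinj) (recenter (fun j => (beta n.+2 lam j.+1)%:R : R)) t
  - level e (tnth mu) (perm qinj) (recenter (fun j => (beta n.+2 lam j.+1)%:R)) u
  = (tnth s t)%:R - (tnth s u)%:R.
  rewrite /level !mxE !permE !qP !natrD; ring.
apply/gap_gt0P => t u tu; have := lE u t.
have h1 : (tnth s t)%:R < (tnth s u)%:R :> R by rewrite ltr_nat slt.
have h2 : (tnth s u)%:R < (tnth s t)%:R + e%:R :> R.
  by rewrite -natrD ltr_nat; have := slte u; lia.
lra.
Qed.

Lemma alcove_set_abacus x : A x -> weight_lattice x -> @S_weights R n.+2 e mu x.
Proof.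
move=> Ax /weight_latticeP[x0 xint].
have eP : (0 < e)%N by lia.
pose l := level e (tnth mu) p x.
(* The levels measured from the first one are integers that increase from 0 and stay below [e]; they
   serve as the runners. *)
have /fin_all_exists[s sP] : forall t, exists k : nat, l t - l ord0 = k%:R.
  move=> t; have : l t - l ord0 \is a Num.int.
    have -> : l t - l ord0 = x 0 (p t) - x 0 (p ord0) -
        ((tnth mu t * e)%:R - (tnth mu ord0 * e)%:R) by rewrite /l /level; ring.
    by rewrite rpredB ?xint// rpredB ?natr_int.
  have : 0 <= l t - l ord0.
    case: Ax => _ /gap_gt0P H; have [t0|t0] := eqVneq t ord0.
      by rewrite t0 subrr.
    rewrite -(inj_eq (@ord_inj _)) -lt0n in t0.
    by have := H ord0 t t0; rewrite /l; lra.
  by move=> l0 lint; apply/natrP; rewrite natrEint lint l0.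
have slt (t u : 'I_n.+2) : (t < u)%N -> (s t < s u)%N.
  by case: Ax => _ /gap_gt0P H /H; rewrite -(ltr_nat R) -!sP /l; lra.
have slte t : (s t < e)%N by rewrite -(ltr_nat R) -sP; exact: level_dist.
(* The beta number of the bead in position [j]: row times [e] plus runner. *)
pose b j := (tnth mu ((p^-1)%g j) * e + s ((p^-1)%g j))%N.
have bE j k : x 0 j - x 0 k = (b j)%:R - (b k)%:R.
  rewrite -[j in LHS](permKV p) -[k in LHS](permKV p) (coord_sub_level e (tnth mu)).
  by rewrite /b !natrD !natrM -!sP /l; ring.
have bd (j k : 'I_n.+2) : (j < k)%N -> (b k < b j)%N.
  move=> /(alcove_set_decreasing ne ps Ax); rewrite -(ltr_nat R).
  by have := bE j k; lra.
have [lam [lamP lams lamb]] := partition_of_beta bd.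
exists lam; last first.
  by rewrite Omega_recenter; apply/esym/recenterP => // j k; rewrite !lamb.
split=> //; exists [tuple s t | t < n.+2]; split.
- apply/(sortedP 0%N) => i; rewrite size_tuple => i1.
  rewrite -[i.+1]/(nat_of_ord (Ordinal i1)) -[i]/(nat_of_ord (Ordinal (ltnW i1))).
  by rewrite -!tnth_nth !tnth_mktuple; apply: slt.
- by apply/allP => _ /tnthP[t ->]; rewrite tnth_mktuple.
- move=> t row; rewrite tnth_mktuple; split=> [[k [/andP[k0 kr]]]|->].
    have k1 : (k.-1 < n.+2)%N by lia.
    have := lamb (Ordinal k1); rewrite /= prednK// => ->.
    rewrite /b divnMDl// modnMDl modn_small// divn_small// addn0 => <- st.
    congr (tnth mu _); apply/ord_inj.
    by have [/slt|/slt|//] := ltngtP ((p^-1)%g (Ordinal k1)) t; rewrite st ltnn.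
  exists (p t).+1; split; first by rewrite /= ltn_ord.
    by rewrite lamb /b permK divnMDl// divn_small// addn0.
  by rewrite lamb /b permK modnMDl modn_small.
Qed.

Lemma alcove_set_weights : A `&` @weight_lattice R n.+2 = @S_weights R n.+2 e mu.
Proof.
apply/seteqP; split=> [x [Ax xP]|_ [lam [lamP _ lamT] <-]].
  exact: alcove_set_abacus.
split; first exact: abacus_alcove_set.
apply/weight_latticeP; rewrite Omega_recenter; split; first exact: recenter_sum_zero.
by move=> j k; rewrite recenter_sub rpredB ?natr_int.
Qed.

Lemma alcove_ofE : alcove_of R e mu = A.
Proof.
have ofA : is_alcove_of e mu A.
  split; [exact: alcove_set_is_alcove|exact: alcove_set_dominant|].
  exact: alcove_set_weights.
apply: xget_subset1 => // B C.
(* An alcove with the same weights contains the lattice point [alcove_center], and two components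
   with a common point coincide. *)
suff H D : is_alcove_of e mu D -> D = A by move=> /H-> /H->.
move=> [[x xH ->] _]; set D' := connected_component _ _ => Dw.
have Ac := alcove_set_center R (tnth mu) p ne.
have : (D' `&` @weight_lattice R n.+2) (alcove_center R e (tnth mu) p).
  rewrite Dw -alcove_set_weights; split=> //; exact: alcove_center_lattice.
move=> [/same_connected_component D'E _].
by rewrite [RHS](alcove_set_component ne Ac) -D'E.
Qed.

End Weights.

(** * The wall shared by two neighbouring alcoves *)

Section Wall.
Variables (R : realType) (n e : nat).
Implicit Types (m : 'I_n.+2 -> nat) (p : {perm 'I_n.+2}) (a t : 'I_n.+2).

Definition wall m p a : set 'rV[R]_n.+2 :=
  [set x | [/\ sum_zero x, forall t, 0 <= gap e m p x t & gap e m p x a = 0]].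

Lemma wall_facet m p a : (n.+2 <= e)%N ->
  is_facet (alcove_set e m p) (wall m p a).
Proof.
move=> ne; have eP : (0 < e)%N by lia.
rewrite /is_facet closure_alcove_set//; split.
  pose c : R := (m a * e)%:R - (m (ordS a) * e)%:R + (if ordS a == ord0 then e%:R else 0).
  have gE x : gap e m p x a = c - dot (pos_root R (p a) (p (ordS a))) x.
    by rewrite dot_pos_rootE /gap /level /c; case: ifP => _; ring.
  (* The gap at [a] is [c] minus a root functional, so its non-negativity is the supporting
     inequality of the face. *)
  exists (pos_root R (p a) (p (ordS a))), c; split=> [x [_ /(_ a)]|].
    by rewrite gE subr_ge0.
  apply/seteqP; split=> [x [x0 xg]|x [[x0 xg]] xc].
    by rewrite gE => /eqP; rewrite subr_eq0 => /eqP.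
  by split; rewrite // gE xc subrr.
(* The wall is spanned by the [n.+1] vertices other than [vertex a], enumerated by [lift a]; the
   closure is spanned by all [n.+2]. *)
exists n; split.
  have := face_aff_dim R m p eP (@lift_inj _ a); congr (aff_dim _ _).
  apply/seteqP; split=> x [x0 xg xa]; split=> //.
    by apply: xa; apply/codomP => -[k /eqP]; rewrite (negPf (neq_lift a k)).
  move=> t ta; case: (unliftP a t) ta => [k ->|->//].
  by rewrite codom_f.
have := face_aff_dim R m p eP (@inj_id 'I_n.+2); congr (aff_dim _ _).
apply/seteqP; split=> x.
  by case.
by case=> x0 xg; split=> // t; rewrite (codom_f id).
Qed.

Variables (m m' : 'I_n.+2 -> nat) (p : {perm 'I_n.+2}) (a b : 'I_n.+2).
(** All reflections at once: the values at [a] and [b] are exchanged, with a shift by one row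
    exactly when the pair wraps around the cycle. *)
Hypotheses (ab : ordS a = b)
  (m'b : m' b = (m a + (b == ord0))%N) (m'a : (m' a + (b == ord0))%N = m b)
  (m't : forall t, t != a -> t != b -> m' t = m t).

Let aNb : a != b.
Proof.
rewrite -ab; apply/eqP => /(congr1 (@nat_of_ord _)).
by rewrite ordS_val; case: eqP; lia.
Qed.

(** Passing from the last runner to the first of the next row is also a step of one in the key, so
    the wrapping pair behaves like any other. *)
Lemma key_ordS : key m' b = (key m a).+1 /\ (key m' a).+1 = key m b.
Proof.
have bE : b = (if a == n.+1 :> nat then 0 else a.+1)%N :> nat.
  by rewrite -ab ordS_val.
move: m'b m'a; rewrite /key -ab ordS_eq0 ab bE.
by case: eqP => [->|_] /=; nia.
Qed.

(** The keys of [a] and [b] are exchanged up to a shift by one. As keys are distinct, such a shift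
    overtakes no third key; the excluded case is the one where no key changes. *)
Lemma sorts_reflect : (key m a).+1 != key m b -> sorts m p ->
  sorts m' (tperm a b * p)%g.
Proof.
have [kb ka] := key_ordS; move=> kab ps t u; rewrite !permM => tu; apply: ps.
have kt v : v != a -> v != b -> key m' v = key m v.
  by move=> va vb; rewrite /key m't.
have kne v w : v != w -> key m v != key m w by rewrite (inj_eq (@key_inj _ m)).
move: tu; case: tpermP => [->|->|/eqP ta /eqP tb];
  case: tpermP => [->|->|/eqP ua /eqP ub]; rewrite ?kb ?(kt _ ta tb) ?(kt _ ua ub).
- lia.
- have := kne _ _ aNb; lia.
- have := kne _ _ ub; lia.
- lia.
- lia.
- lia.
- have := kne _ _ tb; lia.
- have := kne _ _ ta; lia.
- by [].
Qed.

(** The levels of [a] and [b] are exchanged up to the constant [c] of the gap at [a]. When that gap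
    vanishes the two levels differ by exactly [c], so each is unchanged. *)
Lemma gap_reflect x :
  gap e m' (tperm a b * p)%g x a = - gap e m p x a /\
  (gap e m p x a = 0 :> R ->
    forall t, gap e m' (tperm a b * p)%g x t = gap e m p x t).
Proof.
pose c : R := if b == ord0 then e%:R else 0.
have lb : level e m' (tperm a b * p)%g x b = level e m p x a - c.
  rewrite /level permM tpermR m'b /c mulnDl natrD; case: eqP => _.
    by rewrite mul1n; ring.
  by rewrite mul0n; ring.
have la : level e m' (tperm a b * p)%g x a = level e m p x b + c.
  rewrite /level permM tpermL -m'a /c mulnDl natrD; case: eqP => _.
    by rewrite mul1n; ring.
  by rewrite mul0n; ring.
have lt t : t != a -> t != b -> level e m' (tperm a b * p)%g x t = level e m p x t.
  by move=> ta tb; rewrite /level permM tpermD 1?eq_sym// m't.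
have gE q k : gap e k q x a = level e k q x b - level e k q x a + c.
  by rewrite /gap ab.
split; first by rewrite !gE lb la; ring.
rewrite gE => g0 t.
have L s : level e m' (tperm a b * p)%g x s = level e m p x s.
  have [->|sa] := eqVneq s a; first by rewrite la; lra.
  have [->|sb] := eqVneq s b; first by rewrite lb; lra.
  exact: lt.
by rewrite /gap !L.
Qed.

Lemma wall_reflect : wall m' (tperm a b * p)%g a = wall m p a.
Proof.
apply/seteqP; split=> x [x0 xg xa]; have [ga gt] := gap_reflect x.
  have xa' : gap e m p x a = 0 by apply/eqP; rewrite -oppr_eq0 -ga xa.
  by split=> // t; rewrite -gt.
by split=> [//|t|]; [rewrite gt|rewrite ga xa oppr0].
Qed.

End Wall.

(** * The action of the simple reflections, and the conclusion *)

Lemma sigma_actP (n : nat) (mu mu' : n.+2.-tuple nat) (b : 'I_n.+2) :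
  sigma_act b mu = Some mu' ->
  [/\ tnth mu' b = (tnth mu (ord_pred b) + (b == ord0))%N,
      (tnth mu' (ord_pred b) + (b == ord0))%N = tnth mu b &
      forall t, t != ord_pred b -> t != b -> tnth mu' t = tnth mu t].
Proof.
(* With entries counted from 0, the reflection of index [b] acts on entries [b.-1] and [b], and on
   the last and first entries when [b] is 0; in both cases the pair is [ord_pred b], [b]. *)
have predE : ord_pred b = (if b == ord0 then n.+1 else b.-1) :> nat.
  have := ordS_val (ord_pred b); rewrite ord_predK -(inj_eq (@ord_inj _)).
  have := ltn_ord (ord_pred b).
  by case: eqP; case: eqP => /=; lia.
have b0E : (b == ord0) = (b == 0 :> nat) by rewrite -(inj_eq (@ord_inj _)).
have bn := ltn_ord b.
rewrite /sigma_act b0E in predE *; case: (b =P 0%N :> nat) predE => b0 predE.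
  case: ifP => // mu0 [<-]; rewrite /affine_swap !tnth_mktuple b0 predE eqxx /=.
  split=> [||t ta tb].
  - by rewrite (tnth_nth 0%N) predE addn1.
  - by rewrite (tnth_nth 0%N) b0 eqxx addn1 prednK.
  - rewrite -!(inj_eq (@ord_inj _)) b0 predE in ta tb.
    by rewrite tnth_mktuple (negPf ta) (negPf tb) (tnth_nth 0%N).
move=> [<-]; rewrite /swap_adjacent !tnth_mktuple predE eqxx addn0.
split=> [||t ta tb].
- rewrite (_ : (b == b.-1 :> nat) = false); last lia.
  by rewrite (tnth_nth 0%N) predE.
- by rewrite eqxx addn0 (tnth_nth 0%N).
- rewrite tnth_mktuple -predE !(inj_eq (@ord_inj _)) (negPf ta) (negPf tb).
  by rewrite (tnth_nth 0%N).
Qed.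

Theorem theorem3p55 (R : realType) (e r w : nat) (her : (r < e)%N)
    (hr : (3 <= r)%N) (mu mu' : r.-tuple nat) (hmu : weak_composition w mu)
    (i : 'I_r) (hdef : sigma_act i mu = Some mu') :
  mu' = mu \/ have_common_facet (alcove_of R e mu) (alcove_of R e mu').
Proof.
case: r => [|[|n]] // in her hr mu mu' hmu i hdef *.
have [m'b m'a m't] := sigma_actP hdef.
have ab := ord_predK i; set a := ord_pred i in m'b m'a m't ab.
(* Consecutive keys mean that the shift by one undoes the exchange, so that the composition is
   fixed. *)
have [kab|kab] := eqVneq (key (tnth mu) a).+1 (key (tnth mu) i); [left|right].
  have [kb ka] := key_ordS ab m'b m'a.
  have mb : tnth mu' i = tnth mu i.
    by move: kb; rewrite kab /key => /eqP; rewrite eqn_add2r eqn_mul2r => /eqP.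
  have ma : tnth mu' a = tnth mu a.
    by move: ka; rewrite -kab /key => -[] /eqP; rewrite eqn_add2r eqn_mul2r => /eqP.
  apply: eq_from_tnth => t; have [->//|ta] := eqVneq t a.
  by have [->//|tb] := eqVneq t i; exact: m't.
have [p ps] := exists_sorts (tnth mu).
have p's := sorts_reflect ab m'b m'a m't kab ps.
rewrite (alcove_ofE _ (ltnW her) ps) (alcove_ofE _ (ltnW her) p's).
exists (wall e (tnth mu) p a); split; first exact/wall_facet/ltnW.
(* Seen from the second alcove, the same set is the wall at [a]. *)
rewrite -(wall_reflect R e p ab m'b m'a m't); exact/wall_facet/ltnW.
Qed.
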